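(* Let $n \geq 5$ be an integer, let $V$ be a set with exactly $n$ elements, and let $A$ be an anchor in $V$. Then $A$ includes at least $n(n-1)/2$ triangles, that is, $|A| \geq n(n-1)/2$.
   Context: Let $(V,\mathrm{dist})$ be a metric space. A triangle of $V$ is a three-point subset of $V$. A triangle is called degenerate if its points can be labeled as $r,s,t$ (pairwise distinct) so that $\mathrm{dist}(r,s)+\mathrm{dist}(s,t)=\mathrm{dist}(r,t)$; otherwise it is nondegenerate. Given a set $V$, a set $A$ of three-point subsets of $V$ is called an anchor in $V$ if, for every metric $\mathrm{dist}$ on $V$ such that all triangles in $A$ are degenerate in $(V,\mathrm{dist})$, the metric space $(V,\mathrm{dist})$ is isometric to a subset of the real line with the usual Euclidean metric. *)

(* Defs.v *)
From mathcomp Require Import all_boot all_order all_algebra.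
From mathcomp Require Import all_classical all_reals all_analysis.

Set Implicit Arguments.
Unset Strict Implicit.
Unset Printing Implicit Defensive.

Import Order.TTheory GRing.Theory Num.Theory.

Local Open Scope ring_scope.

Definition triangle (V : finType) (T : {set V}) : bool := #|T| == 3%N.

Definition degenerate (R : realType) (V : finType) (dist : V -> V -> R)
    (T : {set V}) : Prop :=
  exists r s t : V,
    [/\ T = [set r; s; t]%SET, [/\ r != s, s != t & r != t]
      & dist r s + dist s t = dist r t].

Definition isometric_to_subset_of_line (R : realType) (V : Type)
    (dist : V -> V -> R) : Prop :=
  exists (X : set R) (f : V -> R),
    set_bij [set: V]%classic X f /\ forall x y : V, `|f x - f y| = dist x y.

(* An inhabitant of [isMetric R V] is a metric on the bare set [V]: a distance
   function together with the proofs of the metric axioms. *)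
Definition anchor (R : realType) (V : finType) (A : {set {set V}}) : Prop :=
  (forall T : {set V}, T \in A -> triangle T) /\
  (forall m : isMetric R V,
     (forall T : {set V}, T \in A -> degenerate (isMetric.mdist m) T) ->
     isometric_to_subset_of_line (isMetric.mdist m)).

(* Main.v *)
Require Import Defs.
From mathcomp Require Import all_boot all_order all_algebra.
From mathcomp Require Import all_classical all_reals all_analysis.
From mathcomp Require Import zify lra fintype finset.

(** Every pair [u], [v] of points must lie in at least three triangles of an
    anchor; as each triangle contains exactly three pairs, counting incidences
    between pairs and triangles of [A] gives [3 * 'C(n, 2) <= 3 * #|A|].

    The bound on a single pair comes from a metric that is not linear although
    almost all its triangles are degenerate: put the points of [V] at
    consecutive integers, with [u] at 1 and [v] at 2, and stretch the single
    distance between [u] and [v] from 1 to 3. Triangles that do not contain both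
    [u] and [v] are untouched, and those formed by [u], [v] and the point at 0
    or at 3 become degenerate again, with the pair [u], [v] as their longest
    side; every other triangle on [u], [v] is nondegenerate, and there is one as
    soon as [V] has five points. If at most two triangles of [A] contain [u] and
    [v], their third points can be placed at 0 and 3, so that this metric makes
    all triangles in [A] degenerate: [A] is not an anchor
    ([anchor_meets_stretch], [anchor_link]). *)

Set Implicit Arguments.
Unset Strict Implicit.
Unset Printing Implicit Defensive.

Import Order.TTheory GRing.Theory Num.Theory.

Local Open Scope nat_scope.

(** The value 3 is the only one that makes both triples [0, 1, 2] and
    [1, 2, 3] degenerate again. *)
Definition stretched (i j : nat) : nat :=
  if ((i == 1) && (j == 2)) || ((i == 2) && (j == 1)) then 3
  else (i - j) + (j - i).

Lemma stretchedxx i : stretched i i = 0.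
Proof. by rewrite /stretched; case: ifP; lia. Qed.

Lemma stretched_eq0 i j : stretched i j = 0 -> i = j.
Proof. by rewrite /stretched; case: ifP; lia. Qed.

Lemma stretched_sym i j : stretched i j = stretched j i.
Proof. by rewrite /stretched; do 2![case: ifP]; lia. Qed.

Lemma stretched_triangle j i k :
  stretched i k <= stretched i j + stretched j k.
Proof. by rewrite /stretched; do 3![case: ifP]; lia. Qed.

Lemma stretched_degenerate i j k : i != j -> j != k -> i != k ->
    ([&& 1 \in [:: i; j; k] & 2 \in [:: i; j; k]] ->
      (0 \in [:: i; j; k]) || (3 \in [:: i; j; k])) ->
  [\/ stretched i j + stretched j k = stretched i k,
      stretched j k + stretched k i = stretched j i |
      stretched k i + stretched i j = stretched k j].
Proof.
move=> ij jk ik; rewrite !inE => h.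
suff : (stretched i j + stretched j k == stretched i k)
    || (stretched j k + stretched k i == stretched j i)
    || (stretched k i + stretched i j == stretched k j).
  case/orP => [/orP[]|] /eqP; [exact: Or31 | exact: Or32 | exact: Or33].
rewrite /stretched; move: ij jk ik h.
(* Splitting off the positions below 3 makes every test for the pair 1, 2
   compute, which leaves plain sums of absolute differences. *)
case: i => [|[|[|i]]]; case: j => [|[|[|j]]]; case: k => [|[|[|k]]] //=; lia.
Qed.

Section StretchedMetric.
Variables (R : realType) (V : finType) (p : V -> nat).
Hypothesis p_inj : injective p.

Let dist (x y : V) : R := ((stretched (p x) (p y))%:R)%R.

Let distxx x : dist x x = 0%R.
Proof. by rewrite /dist stretchedxx. Qed.

Let dist_positivity x y : dist x y = 0%R -> x = y.
Proof.
by move/eqP; rewrite pnatr_eq0 => /eqP /stretched_eq0 /p_inj.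
Qed.

Let dist_sym x y : dist x y = dist y x.
Proof. by rewrite /dist stretched_sym. Qed.

Let dist_triangle y x z : (dist x z <= dist x y + dist y z)%R.
Proof. by rewrite /dist -natrD ler_nat stretched_triangle. Qed.

Definition stretched_metric : isMetric R V :=
  isMetric.Build R V distxx dist_positivity dist_sym dist_triangle.

End StretchedMetric.

Lemma cards3_set (V : finType) (T : {set V}) : #|T| = 3 ->
  exists a b c, T = [set a; b; c]%SET /\ [/\ a != b, b != c & a != c].
Proof.
move=> T3; have := enum_uniq (mem T); have := set_enum T.
have := cardE (mem T); rewrite T3.
case: (enum _) => [|a [|b [|c []]]] //= _ TE.
rewrite !inE => /and3P[/norP[ab ac] bc _].
exists a, b, c; split; last by [].
by rewrite -TE; apply/setP => w; rewrite !inE orbA.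
Qed.

(** Among the points at 1, 2 and 4 the distances are 3, 2 and 3, which no three
    points of the real line realize. *)
Lemma anchor_meets_stretch (R : realType) (V : finType) (A : {set {set V}})
    (p : V -> nat) (u v z : V) :
    anchor R A -> injective p -> p u = 1 -> p v = 2 -> p z = 4 ->
  exists T, [/\ T \in A, u \in T, v \in T
    & forall w, w \in T -> (p w != 0) && (p w != 3)].
Proof.
move=> [A3 Aline] pinj pu pv pz; apply: contrapT => noT.
have [T TA|X [f [_ fE]]] := Aline (stretched_metric R pinj); last first.
  have uv3 : (`|f u - f v| = 3%:R)%R by rewrite fE /= pu pv.
  have uz3 : (`|f u - f z| = 3%:R)%R by rewrite fE /= pu pz.
  have vz2 : (`|f v - f z| = 2%:R)%R by rewrite fE /= pv pz.
  by move: uv3 uz3 vz2; do 3![case: ger0P => _]; lra.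
have /eqP/cards3_set[a [b [c [TE [ab bc ac]]]]] := A3 T TA.
have memT i w : p w = i -> (i \in [:: p a; p b; p c]) = (w \in T).
  by move=> <-; rewrite TE !inE !(inj_eq pinj) orbA.
have [|||/andP[]|e|e|e] := @stretched_degenerate (p a) (p b) (p c).
- by rewrite (inj_eq pinj).
- by rewrite (inj_eq pinj).
- by rewrite (inj_eq pinj).
- rewrite (memT _ _ pu) (memT _ _ pv) => uT vT; apply: contrapT => /negP.
  move=> /norP[no0 no3]; apply: noT; exists T; split=> // w wT.
  apply/andP; split; apply/eqP => pw.
    by move: no0; rewrite (memT _ _ pw) wT.
  by move: no3; rewrite (memT _ _ pw) wT.
- by exists a, b, c; split; rewrite //= -natrD e.
- exists b, c, a; split; last by rewrite /= -natrD e.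
    by rewrite TE; apply/setP => w; rewrite !inE; do 3![case: eqP].
  by rewrite bc eq_sym ac eq_sym ab.
- exists c, a, b; split; last by rewrite /= -natrD e.
    by rewrite TE; apply/setP => w; rewrite !inE; do 3![case: eqP].
  by rewrite ab eq_sym ac eq_sym bc.
Qed.

(** Listing the third points of the triangles of [A] on [u], [v] first puts
    them, when there are at most two, at the positions 0 and 3 around [u] and
    [v]. *)
Lemma anchor_link (R : realType) (V : finType) (A : {set {set V}}) (u v : V) :
    5 <= #|V| -> anchor R A -> u != v ->
  3 <= #|[set w | [set u; v; w] \in A]%SET|.
Proof.
move=> V5 anA uv; rewrite leqNgt; apply/negP; rewrite ltnS.
set W := [set w | _]%SET => W2.
have A3 : forall T, T \in A -> #|T| = 3 by move=> T /(proj1 anA) /eqP.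
have WC : (W \subset ~: [set u; v])%SET.
    apply/subsetP => w; rewrite !inE => /A3.
  case: eqP => [->|_]; first by rewrite setUAC setUid cards2; case: (u == v).
  by case: eqP => // ->; rewrite -setUA setUid cards2; case: (u == v).
(* All points but [u] and [v], those of [W] first; taking one of the first two
   in front of [u] and the other right after [v] gives the positions below. *)
pose l := enum W ++ enum (~: [set u; v] :\: W)%SET.
have memW w : w \in W -> index w l < 2.
  move=> wW; rewrite /l index_cat mem_enum wW.
  by apply: leq_trans W2; rewrite cardE index_mem mem_enum.
have meml w : w \notin [set u; v]%SET -> w \in l.
  by move=> wuv; rewrite mem_cat !mem_enum in_setD in_setC wuv andbT orbN.
have lC w : w \in l -> w \in (~: [set u; v])%SET.
  by rewrite mem_cat !mem_enum => /orP[/(subsetP WC)|/setDP[]].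
have lsize : 3 <= size l.
  rewrite size_cat -!cardE cardsD (setIidPr WC) subnKC ?subset_leq_card //.
  by have := cardsC [set u; v]%SET; rewrite cards2 uv; lia.
have luniq : uniq l.
  rewrite cat_uniq !enum_uniq andbT; apply/hasPn => w.
  by rewrite !mem_enum => /setDP[].
case: l memW meml lC lsize luniq => [|x [|y [|z r]]] // memW meml lC _.
rewrite /= !inE => /andP[/norP[xy /norP[xz _]] /andP[/norP[yz _] _]].
have avoid w : w \in [:: x, y, z & r] -> (w != u) && (w != v).
  by move/lC; rewrite !inE negb_or.
have /andP[xu xv] : (x != u) && (x != v) by apply: avoid; rewrite !inE eqxx.
have /andP[yu yv] : (y != u) && (y != v).
  by apply: avoid; rewrite !inE eqxx orbT.
have /andP[zu zv] : (z != u) && (z != v).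
  by apply: avoid; rewrite !inE eqxx !orbT.
pose s := [:: x, u, v, y, z & r].
have pinj : injective (index^~ s).
  have ins w : w \in s.
    have [->|wu] := eqVneq w u; first by rewrite !inE eqxx !orbT.
    have [->|wv] := eqVneq w v; first by rewrite !inE eqxx !orbT.
    by have := meml w; rewrite !inE (negbTE wu) (negbTE wv); apply.
  by move=> w w'; apply: (index_inj x); rewrite ins.
have pu : index u s = 1 by rewrite /= (negbTE xu) eqxx.
have pv : index v s = 2 by rewrite /= (negbTE xv) (negbTE uv) eqxx.
have pz : index z s = 4.
  rewrite /= (negbTE xz) (eq_sym u) (negbTE zu) (eq_sym v) (negbTE zv).
  by rewrite (negbTE yz) eqxx.
have [T [TA uT vT Tmid]] := anchor_meets_stretch anA pinj pu pv pz.
have : 0 < #|(T :\: [set u; v])%SET|.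
  rewrite cardsD (setIidPr _) ?(A3 _ TA) ?cards2 ?uv //.
  by apply/subsetP => w; rewrite !inE => /orP[] /eqP->.
case/card_gt0P => w /setDP[wT wuv].
have /memW : w \in W.
  rewrite inE; suff -> : [set u; v; w]%SET = T by [].
  apply/eqP; rewrite eqEcard (A3 _ TA) setUC cardsU1 wuv cards2 uv andbT.
  by apply/subsetP => t; rewrite !inE => /or3P[] /eqP->.
have := Tmid w wT; rewrite /=.
have [//|_] /= := eqVneq x w.
have [yw|_] //= := eqVneq y w.
by rewrite -yw (eq_sym u) (negbTE yu) (eq_sym v) (negbTE yv).
Qed.

Theorem theorem5 (R : realType) (n : nat) (V : finType) (A : {set {set V}}) :
  (5 <= n)%N -> #|V| = n -> anchor R A -> (n * (n - 1) %/ 2 <= #|A|)%N.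
Proof.
move=> n5 Vn anA; rewrite subn1 divn2 -bin2 -(leq_pmul2r (isT : 0 < 3)).
have A3 T : T \in A -> #|T| = 3 by move/(proj1 anA)/eqP.
pose pairs := [set P : {set V} | #|P| == 2]%SET.
have -> : 'C(n, 2) * 3 = \sum_(P in pairs) 3.
  by rewrite sum_nat_const card_draws Vn.
have -> : #|A| * 3 = \sum_(T in A) \sum_(P in pairs) (P \subset T).
  rewrite -sum_nat_const; apply: eq_bigr => T /A3 T3.
  transitivity 'C(#|T|, 2); first by rewrite T3.
  rewrite -big_mkcondr /= sum1dep_card -cards_draws.
  by apply: eq_card => P; rewrite !inE andbC.
rewrite exchange_big /=; apply: leq_sum => P.
rewrite inE => /cards2P[u [v [uv ->]]].
rewrite -big_mkcondr /= sum1dep_card.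
apply: leq_trans (anchor_link _ anA uv) _; first by rewrite Vn.
rewrite -(card_in_imset (f := fun w => [set u; v; w]%SET)).
  apply/subset_leq_card/subsetP => T /imsetP[w].
  by rewrite !inE => wA ->; rewrite wA subsetUl.
move=> w w'; rewrite !inE => wA w'A eT.
have : w \in [set u; v; w']%SET by rewrite -eT !inE eqxx orbT.
rewrite !inE => /orP[/orP[]|] /eqP // wE; have := A3 _ wA.
  by rewrite wE setUAC setUid cards2 uv.
by rewrite wE -setUA setUid cards2 uv.
Qed.
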